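(* Let $A$ be the generator of a strongly continuous semigroup $(T(t))_{t\ge0}$ on a complex Banach space $X$. Then for every $t>0$ one has the spectral inclusion $$e^{t\sigma_{BF}(A)}\subseteq\sigma_{BF}(T(t)).$$
   Context: The generator of a strongly continuous semigroup $(T(t))_{t\ge0}$ is $Ax=\lim_{s\downarrow0}\frac{T(s)x-x}{s}$ with domain $D(A)$ the set of $x\in X$ for which the limit exists. For $E\subseteq\mathbb{C}$, $e^{tE}=\{e^{t\mu}:\mu\in E\}$. A closed linear operator $S$ is Fredholm if $\dim N(S)$ and $\operatorname{codim}R(S)$ are both finite, where $N(S)$ is the kernel and $R(S)$ the range. For a linear operator $S$ on $X$ with domain $D(S)$ ($D(S)=X$ if $S$ is bounded) and a nonnegative integer $n$, let $S_n$ be the restriction of $S$ to $R(S^n)$ viewed as a map from $R(S^n)$ into $R(S^n)$ (with domain $D(S)\cap R(S^n)$ in the unbounded case). $S$ is B-Fredholm if for some nonnegative integer $n$ the range $R(S^n)$ is closed and $S_n$ is Fredholm. The B-Fredholm spectrum is $\sigma_{BF}(S)=\{\lambda\in\mathbb{C}: S-\lambda I\text{ is not B-Fredholm}\}$. *)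

(* Defs.v *)
From HB Require Import structures.
From mathcomp Require Import all_boot all_order all_algebra.
From mathcomp Require Import complex.
From mathcomp Require Import all_classical all_reals all_analysis.

Set Implicit Arguments.
Unset Strict Implicit.
Unset Printing Implicit Defensive.

Import Order.TTheory GRing.Theory Num.Theory.
Import numFieldNormedType.Exports.

Local Open Scope classical_set_scope.
Local Open Scope ring_scope.
Local Open Scope complex_scope.

(* Linear operators with a domain: only the values of [op_fun] on [op_dom]
   are meaningful. *)
Record linop (K : numFieldType) (X : normedModType K) := LinOp {
  op_dom : set X;
  op_fun :> X -> X;
  op_dom0 : op_dom 0;
  op_domP : forall (a : K) x y,
    op_dom x -> op_dom y -> op_dom (a *: x + y);
  op_funP : forall (a : K) x y,
    op_dom x -> op_dom y -> op_fun (a *: x + y) = a *: op_fun x + op_fun y }.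

#[local] Obligation Tactic := idtac.

Section Operators.
Context (K : numFieldType) (X : normedModType K).
Implicit Types (S : linop X) (V Y : set X).

Lemma linop0 S : S 0 = 0.
Proof.
have := op_funP 1 (op_dom0 S) (op_dom0 S).
by rewrite !scale1r addr0 => /eqP; rewrite -subr_eq0 opprD addNKr oppr_eq0 => /eqP.
Qed.

Definition op_ker S : set X := [set x | op_dom S x /\ S x = 0].
Definition op_range S : set X := S @` op_dom S.
Definition op_graph S : set (X * X) := [set p | op_dom S p.1 /\ p.2 = S p.1].

Definition total_op (f : {linear X -> X}) : linop X :=
  @LinOp K X setT f I (fun _ _ _ _ _ => I) (fun a x y _ _ => linearP f a x y).

Definition id_op : linop X := total_op idfun.

Program Definition comp_op S1 S2 : linop X :=
  @LinOp K X [set x | op_dom S2 x /\ op_dom S1 (S2 x)] (S1 \o S2) _ _ _.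
Next Obligation. by move=> S1 S2; split; rewrite ?linop0; exact: op_dom0. Qed.
Next Obligation.
move=> S1 S2 a x y [x2 x1] [y2 y1]; split; first exact: op_domP.
by rewrite op_funP//; exact: op_domP.
Qed.
Next Obligation.
by move=> S1 S2 a x y [x2 x1] [y2 y1]; rewrite /= op_funP// op_funP.
Qed.

Definition pow_op S (n : nat) : linop X := iter n (comp_op S) id_op.

Program Definition shift_op S (lambda : K) : linop X :=
  @LinOp K X (op_dom S) (fun x => S x - lambda *: x) _ _ _.
Next Obligation. by move=> S lambda; exact: op_dom0. Qed.
Next Obligation. by move=> S lambda a x y Sx Sy; exact: op_domP. Qed.
Next Obligation.
move=> S lambda a x y Sx Sy /=; rewrite op_funP// scalerDr opprD addrACA.
by rewrite scalerBr !scalerA mulrC.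
Qed.

(* The restriction of S to the range of S^n; it maps that range into itself,
   since S S^n = S^n S on the domain of S^(n+1). *)
Program Definition part_op S (n : nat) : linop X :=
  @LinOp K X (op_dom S `&` op_range (pow_op S n)) S _ _ _.
Next Obligation.
move=> S n; split; first exact: op_dom0.
by exists 0; [exact: op_dom0 | exact: linop0].
Qed.
Next Obligation.
move=> S n a x y [Sx [x' Sx' x'x]] [Sy [y' Sy' y'y]].
split; first exact: op_domP.
exists (a *: x' + y'); first exact: op_domP.
by rewrite op_funP// x'x y'y.
Qed.
Next Obligation. by move=> S n a x y [Sx _] [Sy _]; exact: op_funP. Qed.

Definition finite_dim V :=
  exists n (v : 'I_n -> X),
    V = [set \sum_(i < n) c i *: v i | c in [set: 'I_n -> K]].

(* The quotient Y / V is finite-dimensional (for subspaces V `<=` Y). *)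
Definition finite_codim Y V :=
  exists n (v : 'I_n -> X),
    Y = [set y + \sum_(i < n) c i *: v i | y in V & c in [set: 'I_n -> K]].

(* The graph of S is closed in Y x Y, for the topology induced by X x X. *)
Definition closed_op_in Y S :=
  closure (op_graph S) `&` (Y `*` Y) `<=` op_graph S.

(* S is meant to map op_dom S `<=` Y into Y. *)
Definition fredholm_in Y S :=
  [/\ closed_op_in Y S, finite_dim (op_ker S) & finite_codim Y (op_range S)].

Definition b_fredholm S :=
  exists n : nat, closed (op_range (pow_op S n)) /\
    fredholm_in (op_range (pow_op S n)) (part_op S n).

Definition sigma_BF S : set K :=
  [set lambda | ~ b_fredholm (shift_op S lambda)].

End Operators.

Definition cexp (R : realType) (z : R[i]) : R[i] :=
  (expR (complex.Re z))%:C * (cos (complex.Im z) +i* sin (complex.Im z)).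

Section Semigroups.
Context (R : realType) (X : normedModType R[i]).

(* Only the operators T t with 0 <= t are relevant. *)
Record c0_semigroup (T : R -> {linear X -> X}) : Prop := C0Semigroup {
  c0_bounded : forall t : R, 0 <= t -> continuous (T t);
  c0_id : forall x, T 0 x = x;
  c0_add : forall (s t : R) x, 0 <= s -> 0 <= t -> T (s + t) x = T s (T t x);
  c0_strong : forall x, {within `[0, +oo[, continuous (fun t : R => T t x)} }.

Context (T : R -> {linear X -> X}).

Definition diff_quot (x : X) (s : R) : X := (s^-1)%:C *: (T s x - x).

Lemma diff_quotP (a : R[i]) x y :
  diff_quot (a *: x + y) =
  (fun s => a *: diff_quot x s + diff_quot y s).
Proof.
apply/funext => s; rewrite /diff_quot linearP opprD addrACA -scalerBr.
by rewrite scalerDr !scalerA mulrC.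
Qed.

Lemma diff_quot0 : diff_quot 0 = (fun _ : R => 0 : X).
Proof. by apply/funext => s; rewrite /diff_quot linear0 subr0 scaler0. Qed.

Program Definition generator : linop X :=
  @LinOp _ X [set x | cvg (diff_quot x s @[s --> 0^'+])]
    (fun x => lim (diff_quot x s @[s --> 0^'+])) _ _ _.
Next Obligation. by rewrite /= diff_quot0; exact: is_cvg_cst. Qed.
Next Obligation.
move=> a x y /= cx cy; rewrite diff_quotP.
by apply: is_cvgD => //; exact: is_cvgZl_tmp.
Qed.
Next Obligation.
move=> a x y /= cx cy; rewrite diff_quotP.
by apply/cvg_lim => //; apply: cvgD => //; exact: cvgZl_tmp.
Qed.

End Semigroups.

(* Main.v *)
Require Import Defs.
From HB Require Import structures.
From mathcomp Require Import all_boot all_order all_algebra.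
From mathcomp Require Import complex.
From mathcomp Require Import all_classical all_reals all_analysis.
From mathcomp Require Import lra ring.

Set Implicit Arguments.
Unset Strict Implicit.
Unset Printing Implicit Defensive.

Import Order.TTheory GRing.Theory Num.Theory.
Import numFieldNormedType.Exports.

Local Open Scope classical_set_scope.
Local Open Scope ring_scope.
Local Open Scope complex_scope.

(** The inclusion says that [A - mu] is B-Fredholm as soon as
    [T(t) - e^(t mu)] is.  Write [B = A - mu], the generator of the rescaled
    semigroup [S(s) = e^(- s mu) T(s)].  With the bounded operators
    [L x = int_0^t S(s) x ds] and [M x = int_0^t int_0^s S(r) x dr ds],
    the two identities
    [B L = L B = S(t) - I]  and  [B M = L - t I]
    hold: [S(t) - I] factors through [B], and the cofactor [L] is coprime to
    [B] in the sense of Bezout, since [t I = L - B M].  Up to the nonzero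
    factor [e^(t mu)], the operator [S(t) - I] is [F = T(t) - e^(t mu)].

    From the factorization and the coprimality alone, being B-Fredholm passes
    from [F] to [B] at the same power [n] (lemma [bezout_b_fredholm]).  The
    operator [L - t] maps [R(B^n)] into [R(B^(n+1))], so that modulo
    [R(B^(n+1))] the operator [L] acts on [R(B^n)] as an invertible scalar,
    while [L^n] maps [R(B^n)] into [R(F^n)], which lies in [R(B^n)].  Hence
    - a vector [x] with [L^n x] in [R(B^n)] is itself in [R(B^n)], and
      closedness of [R(F^n)] gives that of [R(B^n)] by continuity of [L];
    - on the kernel of [B], [L] is the scalar [t], so
      [N(B) cap R(B^n)] is contained in [N(F) cap R(F^n)];
    - a finite set completing [R(F^(n+1))] to [R(F^n)] also completes
      [R(B^(n+1))] to [R(B^n)].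

    The analytic part produces [L] and [M].  Integrals of continuous
    functions with values in a Banach space are built as limits of Riemann
    sums on the grids of mesh [1/(n+1)] starting at the origin; the basic
    estimate is that an increment of the sums over [[a, b]] is close to
    [(b - a) v] when the function stays close to [v] there.  Both the
    convergence of the sums and the invariance of the integral under
    translation follow from this local estimate by Cousin's covering
    principle on intervals.  The operator [L] is a pointwise limit of bounded
    operators, hence bounded by the Banach-Steinhaus theorem.  The formulas
    for [B L] and [B M] come from the symmetry
    [(S(h) - I) L_t = (S(t) - I) L_h] (lemma [orbit_integral_symm]) and
    [L_h x / h --> x].  Finally, [B x = y] is equivalent to
    [S(s) x - x = int_0^s S(r) y dr] for all [s >= 0], which shows that the
    graph of [B] is closed. *)

(** * A complex Banach space as a real one *)

Definition linear_of (K : pzRingType) (U W : lmodType K) (f : U -> W)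
  (lf : linear f) : {linear U -> W} := HB.pack f (GRing.isLinear.Build _ _ _ _ f lf).

(** The underlying real Banach space of a complex one.  It keeps the uniform
    structure of [X], so that limits, continuity and completeness are
    literally the same in both spaces; only the scalars and the values of the
    norm change.  The phantom [R] fixes the scalars. *)
Definition realified (R : realType) (X : Type) : Type := X.

Section Realified.
Context (R : realType) (X : completeNormedModType R[i]).
Local Notation V := (realified R X).

HB.instance Definition _ := GRing.Zmodule.copy V X.
HB.instance Definition _ := Complete.copy V X.

Definition rscale (a : R) (x : V) : V := a%:C *: (x : X).

Fact rscaleA a b x : rscale a (rscale b x) = rscale (a * b) x.
Proof. by rewrite /rscale scalerA -rmorphM. Qed.
Fact rscale1 : left_id 1 rscale.
Proof. by move=> x; rewrite /rscale rmorph1 scale1r. Qed.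
Fact rscaleDr : right_distributive rscale +%R.
Proof. by move=> a x y; rewrite /rscale scalerDr. Qed.
Fact rscaleDl x : {morph rscale^~ x : a b / a + b}.
Proof. by move=> a b; rewrite /rscale rmorphD scalerDl. Qed.

HB.instance Definition _ :=
  GRing.Zmodule_isLmodule.Build R V rscaleA rscale1 rscaleDr rscaleDl.

Definition rnorm (x : V) : R := complex.Re `|x : X|.

Lemma rnormE x : (rnorm x)%:C = `|x : X|.
Proof. by rewrite /rnorm RRe_real// normr_real. Qed.

Fact rnormD x y : rnorm (x + y) <= rnorm x + rnorm y.
Proof. by rewrite -lecR rmorphD /= !rnormE ler_normD. Qed.
Fact rnorm0 x : rnorm x = 0 -> x = 0.
Proof. by move=> x0; apply: (@normr0_eq0 _ X); rewrite -rnormE x0. Qed.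
Fact rnormMn x n : rnorm (x *+ n) = rnorm x *+ n.
Proof. by apply: complexI; rewrite rmorphMn /= !rnormE normrMn. Qed.
Fact rnormN x : rnorm (- x) = rnorm x.
Proof. by apply: complexI; rewrite !rnormE normrN. Qed.

HB.instance Definition _ :=
  Num.Zmodule_isNormed.Build R V rnormD rnorm0 rnormMn rnormN.

Definition rball (x : V) (e : R) : set V := ball (x : X) e%:C.

Fact rball_center x (e : R) : 0 < e -> rball x e x.
Proof. by move=> e0; apply: ballxx; rewrite ltcR. Qed.
Fact rball_sym x y (e : R) : rball x e y -> rball y e x.
Proof. exact: ball_sym. Qed.
Fact rball_triangle x y z (e1 e2 : R) :
  rball x e1 y -> rball y e2 z -> rball x (e1 + e2) z.
Proof. rewrite /rball rmorphD; exact: ball_triangle. Qed.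
Fact rball_entourage : entourage = entourage_ rball.
Proof.
rewrite -[LHS]/(@entourage X) -entourage_ballE; apply/seteqP; split=> A [e e0 eA].
  have er : e = (complex.Re e)%:C by rewrite RRe_real// gtr0_real.
  by exists (complex.Re e); [rewrite /= -ltcR -er | rewrite /rball -er].
by exists e%:C => //=; rewrite ltcR.
Qed.

HB.instance Definition _ := Uniform_isPseudoMetric.Build R V
  rball_center rball_sym rball_triangle rball_entourage.

Fact rball_norm : ball = ball_ (fun x : V => `|x|).
Proof.
rewrite -[LHS]/rball; apply/funext => x; apply/funext => e; apply/funext => y.
by rewrite /rball -ball_normE /ball_ /= -rnormE ltcR.
Qed.

HB.instance Definition _ := NormedZmod_PseudoMetric_eq.Build R V rball_norm.

Fact rnormZ (a : R) (x : V) : `|a *: x| = `|a| * `|x|.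
Proof.
apply: complexI; rewrite rmorphM /= !rnormE normrZ; congr (_ * _).
by rewrite normc_def /= expr0n /= addr0 sqrtr_sqr.
Qed.
HB.instance Definition _ :=
  PseudoMetricNormedZmod_Lmodule_isNormedModule.Build R V rnormZ.

End Realified.

(** * Cousin's principle and pointwise limits of operators *)

Section Cousin.
Context (R : realType).

(** Let [s] be the supremum of the points [u] such that [P a u].  Around [s]
    the local hypothesis joins a point of this set to points beyond [s], so
    [s] has to be [b].  This stands in for uniform continuity and for the
    mean value inequality in what follows. *)
Lemma cousin (P : R -> R -> Prop) (a b : R) : a <= b ->
  (forall u v w, u <= v -> v <= w -> P u v -> P v w -> P u w) ->
  (forall c, a <= c <= b -> exists2 r, 0 < r & forall u v,
     a <= u -> u <= c -> c <= v -> v <= b -> c - r < u -> v < c + r -> P u v) ->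
  P a b.
Proof.
move=> ab Pcat Ploc; pose E := [set u | a <= u <= b /\ P a u].
have Ea : E a.
  split; first by rewrite lexx.
  have [r r0 H] := Ploc a (introT andP (conj (lexx _) ab)).
  by apply: H => //; lra.
have supE : has_sup E by split; [exists a | exists b => u [/andP[]]].
have aE : a <= sup E by apply: ub_le_sup => //; exact: supE.2.
have Eb : sup E <= b by apply: ge_sup; [exists a | move=> u [/andP[]]].
have [r r0 H] := Ploc (sup E) (introT andP (conj aE Eb)).
have [u Eu ru] : exists2 u, E u & sup E - r < u by exact: sup_adherent.
have uE : u <= sup E by apply: ub_le_sup => //; exact: supE.2.
pose w := Num.min b (sup E + r / 2).
have wb : w <= b by rewrite ge_min lexx.
have Ew : sup E <= w by rewrite le_min Eb /=; lra.
have wr : w < sup E + r.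
  by apply: (@le_lt_trans _ _ (sup E + r / 2)); [rewrite ge_min lexx orbT | lra].
have [[/andP[au ub] Pau] aw] := (Eu, le_trans aE Ew).
have Paw : P a w.
  by apply: (Pcat a u w) => //; [exact: le_trans Ew | exact: H].
have wE : w <= sup E.
  by apply: ub_le_sup; [exact: supE.2 | split=> //; rewrite aw].
suff <- : w = b by [].
apply/eqP; rewrite eq_le wb /= leNgt; apply/negP => wltb.
by move: wE wltb; rewrite ge_min gt_min ltxx /= => /orP[] *; lra.
Qed.

End Cousin.

Section BanachSteinhaus.
Context (R : realType) (V : completeNormedModType R) (W : normedModType R).

(** Convergent sequences are bounded, so Banach-Steinhaus bounds the [u n]
    uniformly on balls, and such a bound passes to the limit. *)
Lemma continuous_lim_linear (u : nat -> {linear V -> W}) (f : {linear V -> W}) :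
  (forall n, continuous (u n)) -> (forall x, u n x @[n --> \oo] --> f x) ->
  continuous f.
Proof.
move=> ucont uf.
have bnd : uniform_bounded (range (fun n => u n : V -> W)).
  apply: Banach_Steinhauss => [_ [n _ <-]|x].
    split; last exact: linearP.
    exact/(bounded_funP (u n)).2/linear_bounded_continuous/ucont.
  have /cvg_seq_bounded/pinfty_ex_gt0[M M0 /= MP] : cvgn (fun n => u n x).
    by apply/cvg_ex; exists (f x); exact: uf.
  by exists M => _ [n _ <-]; exact: MP.
apply/linear_bounded_continuous/bounded_funP => r.
have [M MP] := bnd r; exists M => x xr.
apply: (cvgr_to_le (cvg_norm (uf x))).
by apply: nearW => n; apply: MP.
Qed.

End BanachSteinhaus.

(** * Integration of continuous functions with values in a Banach space *)

Section Integral.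
Context (R : realType) (V : completeNormedModType R).
Implicit Types (f g : R -> V) (n : nat) (a b u : R).

(** The grid does not depend on [u], which makes the sums additive over
    adjacent intervals.  Right endpoints are used so that the samples counted
    between [a] and [b] lie in that interval and the sum up to [0] is empty. *)
Definition riemann_sum f n u : V :=
  n.+1%:R^-1 *: \sum_(i < Num.truncn (u * n.+1%:R)) f (i.+1%:R / n.+1%:R).

Definition integral f u : V := lim (riemann_sum f n u @[n --> \oo]).

(** All the samples counted between [a] and [b] are within [d] of [v], and
    their number times the mesh is [b - a] up to one mesh. *)
Lemma riemann_sum_near f n a b (v : V) (d : R) : 0 <= a -> a <= b -> 0 <= d ->
  (forall s, a <= s <= b -> `|f s - v| <= d) ->
  `|riemann_sum f n b - riemann_sum f n a - (b - a) *: v| <=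
  (b - a) * d + n.+1%:R^-1 * (d + `|v|).
Proof.
move=> a0 ab d0 fd; rewrite /riemann_sum.
set h := n.+1%:R^-1; set Na := Num.truncn (a * _); set Nb := Num.truncn (b * _).
have n0 : 0 < n.+1%:R :> R by [].
have h0 : 0 < h by rewrite invr_gt0.
have hn : h * n.+1%:R = 1 by rewrite mulVf// gt_eqF.
have NaNb : (Na <= Nb)%N by rewrite le_truncn// ler_wpM2r.
have a0' : 0 <= a * n.+1%:R by rewrite mulr_ge0.
have b0' : 0 <= b * n.+1%:R by rewrite mulr_ge0// (le_trans a0).
have /andP[Na1 Na2] := truncn_itv a0'.
have /andP[Nb1 Nb2] := truncn_itv b0'.
rewrite -/Na -/Nb in Na1 Na2 Nb1 Nb2.
pose N : R := Nb%:R - Na%:R.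
have E : riemann_sum f n b - riemann_sum f n a =
    h *: \sum_(Na <= i < Nb) f (i.+1%:R / n.+1%:R).
  rewrite /riemann_sum -/h -scalerBr -/Na -/Nb; congr (_ *: _).
  rewrite -!(big_mkord xpredT (fun i => f (i.+1%:R / n.+1%:R))).
  by rewrite (big_cat_nat (n := Na))//= addrAC subrr add0r.
rewrite /riemann_sum in E; rewrite E.
have -> : h *: \sum_(Na <= i < Nb) f (i.+1%:R / n.+1%:R) - (b - a) *: v =
    h *: (\sum_(Na <= i < Nb) (f (i.+1%:R / n.+1%:R) - v)) + (h * N - (b - a)) *: v.
  rewrite sumrB sumr_const_nat scalerBr -[v *+ _]scaler_nat scalerA natrB// -/N.
  by rewrite [(h * N - _) *: v]scalerBl addrA subrK.
have hNa : h * Na%:R <= a by rewrite mulrC ler_pdivrMr.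
have hNa' : a < h * Na%:R + h.
  by rewrite -[X in _ + X]mulr1 -mulrDr natr1 mulrC ltr_pdivlMr.
have hNb : h * Nb%:R <= b by rewrite mulrC ler_pdivrMr.
have hNb' : b < h * Nb%:R + h.
  by rewrite -[X in _ + X]mulr1 -mulrDr natr1 mulrC ltr_pdivlMr.
have S1 : `|\sum_(Na <= i < Nb) (f (i.+1%:R / n.+1%:R) - v)| <= N * d.
  rewrite (le_trans (ler_norm_sum _ _ _))//.
  have -> : N * d = \sum_(Na <= i < Nb) d.
    by rewrite sumr_const_nat /N -natrB// mulr_natl.
  apply: ler_sum_nat => i /andP[Nai iNb]; apply: fd; apply/andP; split.
    by rewrite ler_pdivlMr// (le_trans (ltW Na2))// ler_nat.
  by rewrite ler_pdivrMr// (le_trans _ Nb1)// ler_nat.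
rewrite (le_trans (ler_normD _ _))// !normrZ (gtr0_norm h0) [h * (d + _)]mulrDr.
have hN : h * N <= (b - a) + h by rewrite /N mulrBr; lra.
have A1 : h * `|\sum_(Na <= i < Nb) (f (i.+1%:R / n.+1%:R) - v)| <=
    (b - a) * d + h * d.
  rewrite -mulrDl (le_trans _ (ler_wpM2r d0 hN))// -mulrA ler_wpM2l//; exact: ltW.
rewrite [_ + (h * d + _)]addrA lerD// ler_wpM2r// ler_norml /N mulrBr.
by apply/andP; split; lra.
Qed.

Local Notation cont f := {within `[0, +oo[, continuous f}.

Lemma continuous_halflineP f : cont f <->
  forall c e, 0 <= c -> 0 < e -> exists2 r, 0 < r &
    forall s, 0 <= s -> c - r < s -> s < c + r -> `|f s - f c| <= e.
Proof.
split=> [/subspace_continuousP fc c e c0 e0 | H].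
  have /fc /cvgrPdist_le /(_ _ e0) : `[0, +oo[%classic c by rewrite /= in_itv /= c0.
  rewrite near_withinE => /nbhs_ballP[r /= r0 H]; exists r => // s s0 cs sc.
  rewrite distrC; apply: H; last by rewrite /= in_itv /= s0.
  by rewrite /ball /= ltr_norml; apply/andP; split; lra.
apply/subspace_continuousP => c; rewrite /= in_itv /= andbT => c0.
apply/cvgrPdist_le => e e0; have [r r0 {}H] := H c e c0 e0.
rewrite near_withinE; apply/nbhs_ballP; exists r => //= s.
rewrite /ball /= ltr_norml => /andP[? ?]; rewrite in_itv /= andbT => s0.
by rewrite distrC; apply: H => //; lra.
Qed.

Lemma riemann_sum0 f n : riemann_sum f n 0 = 0.
Proof. by rewrite /riemann_sum mul0r truncn0 big_ord0 scaler0. Qed.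

(** Cousin's principle applies to the intervals over which, for every
    positive [eta], the increments of all fine enough sums differ by at most
    [d] times the length plus [eta].  The slack [eta], which is shared between
    adjacent intervals, absorbs the error of one mesh. *)
Lemma riemann_sum_cauchy f b e : cont f -> 0 <= b -> 0 < e ->
  exists N, forall n m, (N <= n)%N -> (N <= m)%N ->
    `|riemann_sum f n b - riemann_sum f m b| <= e.
Proof.
move=> /continuous_halflineP fc b0 e0.
(* The total length b contributes at most e / 2; 1 is added to allow b = 0. *)
pose d := e / (2 * (b + 1)).
have d0 : 0 < d by rewrite divr_gt0//; lra.
pose P u v := forall eta, 0 < eta -> exists N, forall n m,
  (N <= n)%N -> (N <= m)%N ->
  `|(riemann_sum f n v - riemann_sum f n u) -
    (riemann_sum f m v - riemann_sum f m u)| <= d * (v - u) + eta.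
suff /(_ (e / 2)) : P 0 b.
  move=> [|N NP]; first by lra.
  exists N => n m Nn Nm; have := NP n m Nn Nm; rewrite !riemann_sum0 !subr0.
  move=> /le_trans; apply.
  have : d * b <= d * (b + 1) by rewrite ler_wpM2l//; [exact: ltW | lra].
  have -> : d * (b + 1) = e / 2 by rewrite /d; field; apply/lt0r_neq0; lra.
  lra.
apply: cousin => //.
  move=> u v w uv vw Puv Pvw eta eta0.
  have eta2 : 0 < eta / 2 by lra.
  have [N1 H1] := Puv _ eta2; have [N2 H2] := Pvw _ eta2.
  exists (maxn N1 N2) => n m; rewrite !geq_max => /andP[n1 n2] /andP[m1 m2].
  have := lerD (H1 n m n1 m1) (H2 n m n2 m2).
  rewrite (_ : _ + eta / 2 + _ = d * (w - u) + eta); last by field.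
  apply: le_trans; apply: le_trans (ler_normD _ _).
  rewrite le_eqVlt; apply/orP; left; apply/eqP; congr `|_|.
  set A := riemann_sum f n; set C := riemann_sum f m.
  rewrite -[A w - A u](subrKA (A v)) -[C w - C u](subrKA (C v)).
  by rewrite opprD addrACA [RHS]addrC.
move=> c /andP[c0 cb]; have [|r r0 H] := fc c (d / 2) c0; first lra.
exists r => // u v u0 uc cv vb cru vcr eta eta0.
pose q : R := d / 2 + `|f c|.
have q0 : 0 < q by rewrite ltr_pwDl//; lra.
pose N := Num.truncn (q / (eta / 2)).
have Nq n : (N <= n)%N -> n.+1%:R^-1 * q <= eta / 2.
  move=> Nn; rewrite mulrC ler_pdivrMr// -ler_pdivrMl//; last lra.
  rewrite mulrC (le_trans (ltW (truncnS_gt _)))// ler_nat ltnS//.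
have near_c s : u <= s <= v -> `|f s - f c| <= d / 2.
  by move=> /andP[? ?]; apply: H; lra.
exists N => n m Nn Nm.
have uv : u <= v by lra.
have d20 : 0 <= d / 2 by lra.
have Hn := riemann_sum_near n u0 uv d20 near_c.
have Hm := riemann_sum_near m u0 uv d20 near_c.
rewrite -/q in Hn Hm.
have := Nq n Nn; have := Nq m Nm.
set x := riemann_sum f n v - _ in Hn *; set y := riemann_sum f m v - _ in Hm *.
have -> : x - y = (x - (v - u) *: f c) - (y - (v - u) *: f c).
  by rewrite [in RHS]opprB subrKA.
have := ler_normB (x - (v - u) *: f c) (y - (v - u) *: f c).
move=> n1 n2 n3; apply: le_trans n1 (le_trans (lerD Hn Hm) _).
have -> : (v - u) * (d / 2) = d * (v - u) / 2 by rewrite mulrA [_ * d]mulrC.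
move: (n.+1%:R^-1 * q) (m.+1%:R^-1 * q) (d * (v - u)) n2 n3 => A C D n2 n3.
by clear - n2 n3; lra.
Qed.

Lemma riemann_sum_cvg f u : cont f -> 0 <= u ->
  riemann_sum f n u @[n --> \oo] --> integral f u.
Proof.
move=> fc u0; suff : cvg (riemann_sum f n u @[n --> \oo]) by [].
apply: cauchy_cvg; apply: cauchy_exP => e e0.
have e20 : 0 < e / 2 by lra.
have [N NP] := riemann_sum_cauchy fc u0 e20.
exists (riemann_sum f N u), N => // n /= Nn.
rewrite -ball_normE /ball_ /=; apply: le_lt_trans (NP _ _ (leqnn _) Nn) _; lra.
Qed.

Lemma integral0 f : integral f 0 = 0.
Proof.
rewrite /integral (_ : (fun n => _) = fun=> 0) ?lim_cst//.
by apply/funext => n; rewrite riemann_sum0.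
Qed.

Lemma integral_near f a b (v : V) (d : R) : cont f -> 0 <= a -> a <= b ->
  (forall s, a <= s <= b -> `|f s - v| <= d) ->
  `|integral f b - integral f a - (b - a) *: v| <= (b - a) * d.
Proof.
move=> fc a0 ab fd.
have d0 : 0 <= d by rewrite (le_trans _ (fd a _))// lexx.
have Ia := riemann_sum_cvg fc a0; have Ib := riemann_sum_cvg fc (le_trans a0 ab).
pose q := d + `|v|.
have : `|riemann_sum f n b - riemann_sum f n a - (b - a) *: v| - n.+1%:R^-1 * q
    @[n --> \oo] --> `|integral f b - integral f a - (b - a) *: v| - 0 * q.
  apply: cvgB.
    by apply: cvg_norm; apply: cvgB; [exact: cvgB | exact: cvg_cst].
  by apply: cvgMr_tmp; exact: cvg_harmonic.
rewrite mul0r subr0 => /cvgr_to_le; apply; apply: nearW => n.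
by rewrite lerBlDr; exact: riemann_sum_near.
Qed.

Lemma integral_cst (v : V) u : 0 <= u -> integral (fun=> v) u = u *: v.
Proof.
move=> u0; apply/eqP; rewrite -subr_eq0 -normr_le0.
have := @integral_near (fun=> v) 0 u v 0; rewrite integral0 !subr0 mulr0; apply=> //.
  by apply: continuous_subspaceT => x; exact: cvg_cst.
by move=> s _; rewrite subrr normr0.
Qed.

Lemma integralD f g u : cont f -> cont g -> 0 <= u ->
  integral (fun s => f s + g s) u = integral f u + integral g u.
Proof.
move=> fc gc u0; apply/cvg_lim => //.
rewrite (_ : (fun n => _) = (fun n => riemann_sum f n u + riemann_sum g n u)).
  by apply: cvgD; exact: riemann_sum_cvg.
by apply/funext => n; rewrite /riemann_sum big_split scalerDr.
Qed.

(** A mean value theorem for vector-valued functions: if the increments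
    around each point are negligible with respect to the length, they sum up
    to arbitrarily small quantities. *)
Lemma flat_increments_cst (phi : R -> V) b : 0 <= b ->
  (forall c e, 0 <= c -> 0 < e -> exists2 r, 0 < r & forall u v,
     0 <= u -> u <= c -> c <= v -> c - r < u -> v < c + r ->
     `|phi v - phi u| <= e * (v - u)) ->
  phi b = phi 0.
Proof.
move=> b0 H; apply/eqP; rewrite -subr_eq0 -normr_le0; apply/ler_addgt0Pl => e e0.
rewrite addr0; pose d := e / (b + 1).
have d0 : 0 < d by rewrite divr_gt0//; lra.
have de : d * (b - 0) <= e.
  have : d * (b - 0) <= d * (b + 1) by rewrite ler_wpM2l//; [exact: ltW | lra].
  by rewrite divfK//; apply/lt0r_neq0; lra.
apply: le_trans de.
apply: (cousin (P := fun u v => `|phi v - phi u| <= d * (v - u))) => //.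
  move=> u v w uv vw uvP vwP; rewrite -[phi w - _](subrKA (phi v)).
  have := ler_normD (phi w - phi v) (phi v - phi u).
  have -> : d * (w - u) = d * (w - v) + d * (v - u) by ring.
  by move=> /le_trans; apply; exact: lerD.
move=> c /andP[c0 cb]; have [r r0 {}H] := H c d c0 d0.
by exists r => // u v u0 uc cv _; exact: H.
Qed.

Lemma continuous_halfline_shift f h : cont f -> 0 <= h -> cont (fun s => f (s + h)).
Proof.
move=> /continuous_halflineP fc h0; apply/continuous_halflineP => c e c0 e0.
have [|r r0 H] := fc (c + h) e _ e0; first lra.
by exists r => // s s0 cs sc; apply: H; lra.
Qed.

(** The grids of the two integrals do not match unless [h] is a multiple of
    the mesh, but around [c] both sides have increments close to
    [(b - a) f (c + h)], so their difference has flat increments. *)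
Lemma integral_shift f h u : cont f -> 0 <= h -> 0 <= u ->
  integral (fun s => f (s + h)) u = integral f (u + h) - integral f h.
Proof.
move=> fc h0 u0; have fhc := continuous_halfline_shift fc h0.
apply/eqP; rewrite -subr_eq0; apply/eqP.
pose phi u := integral (fun s => f (s + h)) u - integral f (u + h).
have -> : integral (fun s => f (s + h)) u - (integral f (u + h) - integral f h) =
  phi u - phi 0 by rewrite /phi integral0 !add0r opprB opprK addrA addrAC.
apply/eqP; rewrite subr_eq0; apply/eqP; apply: flat_increments_cst => // c e c0 e0.
move/continuous_halflineP: (fhc) => /(_ c (e / 2) c0) [|r r0 H]; first lra.
exists r => // a b a0 ac cb car bcr.
have ab : a <= b by lra.
have H1 s : a <= s <= b -> `|f (s + h) - f (c + h)| <= e / 2.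
  by move=> /andP[? ?]; apply: H; lra.
have H2 s : a + h <= s <= b + h -> `|f s - f (c + h)| <= e / 2.
  move=> /andP[? ?]; rewrite -[s](subrK h); apply: H1; lra.
have := integral_near fhc a0 ab H1.
have ah0 : 0 <= a + h by lra.
have abh : a + h <= b + h by lra.
have := integral_near fc ah0 abh H2.
have -> : b + h - (a + h) = b - a by ring.
move=> N2 N1.
have E (p q p1 q1 z : V) : (p - p1) - (q - q1) = (p - q - z) - (p1 - q1 - z).
  by rewrite [- (_ - _ - _)]opprB subrKA !opprD addrACA.
rewrite /phi (E _ _ _ _ ((b - a) *: f (c + h))).
apply: le_trans (ler_normB _ _) (le_trans (lerD N1 N2) _).
by rewrite -mulrDr -splitr mulrC.
Qed.

Lemma integral_continuous f : cont f -> cont (integral f).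
Proof.
move=> fc; apply/continuous_halflineP => c e c0 e0.
move/continuous_halflineP: (fc) => /(_ c 1 c0 ltr01) [r r0 H].
pose q := 1 + `|f c|; have q0 : 0 < q by rewrite ltr_pwDl.
have est a b : 0 <= a -> a <= b -> a <= c <= b -> c - r < a -> b < c + r ->
    `|integral f b - integral f a| <= (b - a) * q.
  move=> a0 ab /andP[ac cb] car bcr.
  have near_c s : a <= s <= b -> `|f s - f c| <= 1.
    by move=> /andP[? ?]; apply: H; lra.
  have := integral_near fc a0 ab near_c.
  have := ler_normD (integral f b - integral f a - (b - a) *: f c) ((b - a) *: f c).
  rewrite subrK normrZ ger0_norm ?subr_ge0// => /le_trans + N1; apply.
  by rewrite /q mulrDr lerD2r.
have eq0 : 0 < e / q by exact: divr_gt0.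
exists (Num.min r (e / q)); first by rewrite lt_min r0.
move=> s s0; rewrite ltrBlDr -ltrBlDl lt_min => /andP[s1 s2].
rewrite -ltrBlDl lt_min => /andP[s3 s4].
have [sc|/ltW cs] := leP s c.
  rewrite distrC; apply: (le_trans (est s c _ _ _ _ _)); rewrite ?sc ?lexx//; try lra.
  by rewrite -ler_pdivlMr// ltW.
apply: (le_trans (est c s _ _ _ _ _)); rewrite ?cs ?lexx//; try lra.
by rewrite -ler_pdivlMr// ltW.
Qed.

Lemma integral_right_derivative f : cont f ->
  h^-1 *: integral f h @[h --> 0^'+] --> f 0.
Proof.
move=> fc; apply/cvgrPdist_le => e e0.
move/continuous_halflineP: (fc) => /(_ 0 e (lexx 0) e0) [r r0 H].
near=> h; have h0 : 0 < h by near: h; exact: nbhs_right_gt.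
have hr : h < r by near: h; exact: nbhs_right_lt.
have near_0 s : 0 <= s <= h -> `|f s - f 0| <= e by move=> /andP[? ?]; apply: H; lra.
have := integral_near fc (lexx 0) (ltW h0) near_0.
rewrite integral0 !subr0 => N1.
have -> : f 0 - h^-1 *: integral f h = h^-1 *: - (integral f h - h *: f 0).
  by rewrite opprB scalerBr scalerA mulVf ?scale1r// gt_eqF.
by rewrite normrZ normrN gtr0_norm ?invr_gt0// mulrC ler_pdivrMr// mulrC.
Unshelve. all: by end_near. Qed.

End Integral.

Lemma integral_map (R : realType) (V W : completeNormedModType R)
    (A : {linear V -> W}) (f : R -> V) (u : R) : continuous A ->
  {within `[0, +oo[, continuous f} -> 0 <= u ->
  integral (A \o f) u = A (integral f u).
Proof.
move=> Ac fc u0; apply/cvg_lim => //.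
rewrite (_ : (fun n => _) = (fun n => A (riemann_sum f n u))).
  exact: (cvg_comp _ _ (riemann_sum_cvg fc u0) (Ac _)).
apply/funext => n; rewrite /riemann_sum linearZ /=; congr (_ *: _).
by rewrite [RHS]linear_sum.
Qed.

(** All the samples are taken at nonnegative arguments. *)
Lemma eq_integral (R : realType) (V : completeNormedModType R)
    (f g : R -> V) (u : R) :
  (forall s, 0 <= s -> f s = g s) -> integral f u = integral g u.
Proof.
move=> fg; rewrite /integral; congr (lim (_ @ \oo)); apply/funext => n.
by congr (_ *: _); apply: eq_bigr => i _; rewrite fg// divr_ge0.
Qed.

Lemma continuous_halfline_comp (R : realType) (V W : normedModType R)
    (A : V -> W) (f : R -> V) :
  continuous A -> {within `[0, +oo[, continuous f} ->
  {within `[0, +oo[, continuous (A \o f)}.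
Proof.
move=> Ac /subspace_continuousP fc; apply/subspace_continuousP => s s0.
exact: (cvg_comp _ _ (fc s s0) (Ac _)).
Qed.

(** * The complex exponential *)

Section ComplexExp.
Context (R : realType).

Lemma cvg_real_complex (T : Type) (F : set_system T) (FF : Filter F)
    (f : T -> R) (l : R) :
  f x @[x --> F] --> l -> ((f x)%:C : R[i]^o) @[x --> F] --> (l%:C : R[i]^o).
Proof.
move=> /cvgrPdist_lt fl; apply/cvgrPdist_lt => e e0.
have er : e = (complex.Re e)%:C by rewrite RRe_real// gtr0_real.
have e0' : 0 < complex.Re e by rewrite -ltcR -er.
apply: filterS (fl _ e0') => x.
by rewrite -rmorphB normc_def /= expr0n addr0 sqrtr_sqr er ltcR.
Qed.

Lemma cexp0 : cexp (0 : R[i]) = 1.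
Proof. by rewrite /cexp /= expR0 cos0 sin0 mul1r. Qed.

Lemma cexpD (z w : R[i]) : cexp (z + w) = cexp z * cexp w.
Proof.
case: z w => [a b] [c d]; rewrite /cexp /= expRD cosD sinD rmorphM mulrACA.
congr (_ * _); simpc; congr (_ +i* _); ring.
Qed.

Lemma cexp_neq0 (z : R[i]) : cexp z != 0.
Proof.
apply/eqP => z0; have := cexpD z (- z); rewrite subrr cexp0 z0 mul0r.
by move/eqP; rewrite oner_eq0.
Qed.

Lemma cexpE (z : R[i]) : cexp z =
  (expR (complex.Re z) * cos (complex.Im z))%:C +
  'i%C *: ((expR (complex.Re z) * sin (complex.Im z))%:C : R[i]^o).
Proof. by rewrite /GRing.scale /= /cexp !rmorphM /=; simpc. Qed.

Lemma Re_mulrc (s : R) (z : R[i]) : complex.Re (s%:C * z) = s * complex.Re z.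
Proof. by case: z => a b /=; rewrite mul0r subr0. Qed.

Lemma Im_mulrc (s : R) (z : R[i]) : complex.Im (s%:C * z) = s * complex.Im z.
Proof. by case: z => a b /=; rewrite mul0r addr0. Qed.

Lemma cexp_continuous (mu : R[i]) :
  continuous (fun s : R => cexp (s%:C * mu) : R[i]^o).
Proof.
move=> s; rewrite /continuous_at.
have E u : cexp (u%:C * mu) =
    (expR (u * complex.Re mu) * cos (u * complex.Im mu))%:C +
    'i%C *: ((expR (u * complex.Re mu) * sin (u * complex.Im mu))%:C : R[i]^o).
  by rewrite cexpE Re_mulrc Im_mulrc.
rewrite E; under eq_cvg do rewrite E.
have ce : expR (u * complex.Re mu) @[u --> s] --> expR (s * complex.Re mu).
  apply: continuous_comp; [exact: mulrr_continuous | exact: continuous_expR].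
have cc : cos (u * complex.Im mu) @[u --> s] --> cos (s * complex.Im mu).
  apply: continuous_comp; [exact: mulrr_continuous | exact: continuous_cos].
have cs : sin (u * complex.Im mu) @[u --> s] --> sin (s * complex.Im mu).
  apply: continuous_comp; [exact: mulrr_continuous | exact: continuous_sin].
apply: cvgD; first by apply: cvg_real_complex; exact: cvgM.
by apply: cvgZl_tmp; apply: cvg_real_complex; exact: cvgM.
Qed.

Lemma cexp_derivative0 (mu : R[i]) :
  ((h^-1)%:C * (cexp (h%:C * mu) - 1) : R[i]^o) @[h --> (0 : R)^'+] -->
    (mu : R[i]^o).
Proof.
pose a := complex.Re mu; pose b := complex.Im mu.
pose f h := expR (h * a) * cos (h * b); pose g h := expR (h * a) * sin (h * b).
have E h : (h^-1)%:C * (cexp (h%:C * mu) - 1) =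
    (h^-1 * (f h - f 0))%:C + 'i%C *: ((h^-1 * (g h - g 0))%:C : R[i]^o).
  rewrite cexpE Re_mulrc Im_mulrc -/a -/b -/(f h) -/(g h).
  have -> : f 0 = 1 by rewrite /f !mul0r expR0 cos0 mulr1.
  have -> : g 0 = 0 by rewrite /g !mul0r expR0 sin0 mulr0.
  rewrite subr0 /f /g /GRing.scale /= !rmorphM rmorphB rmorph1 !rmorphM /=; ring.
under eq_cvg do rewrite E.
have df : is_derive (0 : R) 1 f a.
  apply: is_derive_eq; rewrite !mul0r expR0 cos0 sin0 /GRing.scale /=; ring.
have dg : is_derive (0 : R) 1 g b.
  apply: is_derive_eq; rewrite !mul0r expR0 cos0 sin0 /GRing.scale /=; ring.
have D (k : R -> R) l : is_derive (0 : R) 1 k l ->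
    h^-1 * (k h - k 0) @[h --> (0 : R)^'+] --> l.
  move=> [dk <-]; set q := fun h : R => h^-1 *: ((k \o shift 0) (h *: 1) - k 0).
  have qD : q @ 0^' --> 'D_1 k 0 := dk.
  have /cvg_dnbhs_at_right qD' := qD.
  apply: cvg_trans qD'; apply: near_eq_cvg; apply: nearW => h.
  by rewrite /q /= addr0 [h *: 1]mulr1.
rewrite [mu]complexE.
apply: cvgD; first by apply: cvg_real_complex; exact: D.
by apply: cvgZl_tmp; apply: cvg_real_complex; exact: D.
Qed.

End ComplexExp.

(** * Semigroups and their integrated orbits *)

Section SemigroupIntegral.
Context (R : realType) (X : completeNormedModType R[i]).
Context (T : R -> {linear X -> X}) (hT : c0_semigroup T).
Local Notation V := (realified R X).

Lemma linear_realified (A : {linear X -> X}) : linear (A : V -> V).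
Proof. by move=> a x y; exact: linearP. Qed.

Definition realified_map (A : {linear X -> X}) : {linear V -> V} :=
  linear_of (linear_realified A).

Definition orbit (x : X) (s : R) : V := T s x.

(** The operator [int_0^t T(s) ds]. *)
Definition orbit_integral (t : R) (x : X) : X := integral (orbit x) t.
Local Notation L := orbit_integral.

(** The graph of the generator, as a relation that does not refer to values
    outside the domain. *)
Definition generates (x y : X) := diff_quot T x s @[s --> 0^'+] --> y.

Lemma orbit_cont x : {within `[0, +oo[, continuous (orbit x)}.
Proof. exact: (c0_strong hT). Qed.
Arguments orbit_cont x : clear implicits.

Lemma orbit_integral_linear t : 0 <= t -> linear (L t).
Proof.
move=> t0 a x y; rewrite /L.
have lin : linear (fun z : X => a *: z).
  by move=> b u v; rewrite scalerDr !scalerA mulrC.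
have cont_a : continuous (realified_map (linear_of lin)).
  by move=> z; apply: (@cvgZl_tmp _ X); exact: cvg_id.
rewrite -[X in _ = X + _](integral_map cont_a (orbit_cont x) t0).
have ax_cont := continuous_halfline_comp cont_a (orbit_cont x).
rewrite -(integralD ax_cont (orbit_cont y) t0).
by apply: (@eq_integral R V) => s _; rewrite /orbit linearP.
Qed.

(** The Riemann sums are bounded operators that converge pointwise. *)
Lemma orbit_integral_continuous t : 0 <= t -> continuous (L t).
Proof.
move=> t0.
have lin n : linear (fun x : V => riemann_sum (orbit x) n t).
  move=> a x y; rewrite /riemann_sum.
  rewrite [a *: (_ *: _)]scalerA [a * _]mulrC -scalerA -scalerDr.
  congr (_ *: _).
  rewrite scaler_sumr -big_split; apply: eq_bigr => i _ /=.
  by rewrite /orbit; exact: linearP.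
have linL : linear (L t : V -> V).
  by move=> a x y; exact: orbit_integral_linear.
apply: (@continuous_lim_linear R V V (fun n => linear_of (lin n)) (linear_of linL)).
  move=> n x; rewrite /continuous_at /= /riemann_sum.
  apply: cvgZl_tmp; apply: cvg_big => [|i _].
    by move=> p; apply: cvgD; [exact: cvg_fst | exact: cvg_snd].
  exact: (c0_bounded hT).
by move=> x; exact: riemann_sum_cvg (orbit_cont x) t0.
Qed.

Lemma semigroup_orbit_integral h t x : 0 <= h -> 0 <= t ->
  T h (L t x) = L (t + h) x - L h x.
Proof.
move=> h0 t0.
have Th : continuous (realified_map (T h)) by exact: (c0_bounded hT h0).
rewrite -[LHS](integral_map Th (orbit_cont x) t0).
rewrite -[RHS](integral_shift (orbit_cont x) h0 t0).
by apply: (@eq_integral R V) => s s0; rewrite /= /orbit addrC (c0_add hT).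
Qed.

(** Both sides are [int_0^(t+h) T(s) x ds] minus the integrals over [[0, t]]
    and over [[0, h]]. *)
Lemma orbit_integral_symm h t x : 0 <= h -> 0 <= t ->
  T h (L t x) - L t x = T t (L h x) - L h x.
Proof.
by move=> h0 t0; rewrite !semigroup_orbit_integral// [h + t]addrC addrAC.
Qed.

Lemma orbit_integral_commute h t x : 0 <= h -> 0 <= t ->
  L t (T h x) = T h (L t x).
Proof.
move=> h0 t0.
have Th : continuous (realified_map (T h)) by exact: (c0_bounded hT h0).
rewrite -[RHS](integral_map Th (orbit_cont x) t0).
apply: (@eq_integral R V) => s s0; rewrite /= /orbit.
by rewrite -!(c0_add hT)// addrC.
Qed.

Lemma orbit_integral_derivative x : (h^-1)%:C *: L h x @[h --> 0^'+] --> x.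
Proof.
have := integral_right_derivative (orbit_cont x).
by rewrite {2}/orbit (c0_id hT).
Qed.

(** By symmetry, [(T h - I) L_t x / h] is [(T t - I)] applied to [L_h x / h],
    which tends to [x]. *)
Lemma orbit_integral_generates t x : 0 <= t -> generates (L t x) (T t x - x).
Proof.
move=> t0; have LD := @orbit_integral_derivative x.
have : T t ((h^-1)%:C *: L h x) - (h^-1)%:C *: L h x @[h --> 0^'+] --> T t x - x.
  by apply: cvgB => //; apply: (cvg_comp _ _ LD); exact: (c0_bounded hT t0).
apply: cvg_trans; apply: near_eq_cvg; near=> h.
have h0 : 0 <= h by apply: ltW; near: h; exact: nbhs_right_gt.
by rewrite /diff_quot orbit_integral_symm// linearZ scalerBr.
Unshelve. all: by end_near. Qed.

Lemma cvg_at_right_unique (f : R -> X) (l l' : X) :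
  f h @[h --> 0^'+] --> l -> f h @[h --> 0^'+] --> l' -> l = l'.
Proof. by move=> fl fl'; apply: (cvg_unique _ fl fl'). Qed.

(** [L_t] is continuous and commutes with the semigroup, so it maps the
    difference quotients of [x] to those of [L_t x]. *)
Lemma generates_orbit_integral t x y : 0 <= t -> generates x y ->
  L t y = T t x - x.
Proof.
move=> t0 xy; apply: cvg_at_right_unique (@orbit_integral_generates t x t0).
have : L t (diff_quot T x h) @[h --> 0^'+] --> L t y.
  have Lc : continuous (L t) by exact: orbit_integral_continuous.
  exact: (cvg_comp _ _ xy (Lc _)).
apply: cvg_trans; apply: near_eq_cvg; near=> h.
have h0 : 0 <= h by apply: ltW; near: h; exact: nbhs_right_gt.
pose Lt := linear_of (orbit_integral_linear t0).
rewrite -[L t _]/(Lt _) /diff_quot linearZ linearB /=.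
by rewrite orbit_integral_commute.
Unshelve. all: by end_near. Qed.

(** The differential equation in integrated form, which only involves
    bounded operators. *)
Lemma generatesP x y :
  generates x y <-> forall t, 0 <= t -> L t y = T t x - x.
Proof.
split=> [xy t t0|H]; first exact: generates_orbit_integral.
apply: cvg_trans (@orbit_integral_derivative y); apply: near_eq_cvg; near=> h.
have h0 : 0 <= h by apply: ltW; near: h; exact: nbhs_right_gt.
by rewrite /diff_quot H.
Unshelve. all: by end_near. Qed.

(** In integrated form, membership in the graph is an intersection of closed
    conditions, one for each time. *)
Lemma generates_closed : closed [set p : X * X | generates p.1 p.2].
Proof.
pose phi t (p : X * X) := L t p.2 - (T t p.1 - p.1).
have -> : [set p : X * X | generates p.1 p.2] =
    \bigcap_(t in [set t | 0 <= t]) (phi t @^-1` [set 0]).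
  apply/seteqP; split=> p.
    by move=> /generatesP H t t0; rewrite /phi /= H// subrr.
  move=> H; apply/generatesP => t t0; have /eqP := H t t0.
  by rewrite subr_eq0 => /eqP.
apply: closed_bigI => t t0.
apply: (continuous_closedP _).1; last first.
  exact/accessible_closed_set1/hausdorff_accessible/norm_hausdorff.
move=> p; apply: cvgB; last apply: cvgB.
- by apply: continuous_comp; [exact: cvg_snd | exact: orbit_integral_continuous].
- by apply: continuous_comp; [exact: cvg_fst | exact: (c0_bounded hT t0)].
- exact: cvg_fst.
Qed.

(** The orbit of a vector killed by the generator is constant. *)
Lemma generates_fixed x t : generates x 0 -> 0 <= t -> L t x = t%:C *: x.
Proof.
move=> x0 t0; rewrite -[RHS](integral_cst (x : V) t0).
apply: (@eq_integral R V) => s s0.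
have L0 : L s 0 = 0 :> X by exact: (linear0 (linear_of (orbit_integral_linear s0))).
by apply/eqP; rewrite -subr_eq0 -(generates_orbit_integral s0 x0) L0.
Qed.

(** The operator [int_0^t int_0^s T(r) dr ds]. *)
Definition orbit_integral2 (t : R) (x : X) : X :=
  integral (fun s => L s x : V) t.

(** Under the outer integral, symmetry turns [(T h - I) L_s x] into
    [(T s - I) L_h x].  Integrating in [s] gives [(L_t - t) L_h x]; divided
    by [h] it converges because [L_h x / h] does, without any exchange of
    limit and integral. *)
Lemma orbit_integral2_generates t x : 0 <= t ->
  generates (orbit_integral2 t x) (L t x - t%:C *: x).
Proof.
move=> t0; have LD := @orbit_integral_derivative x.
pose g h : X := L t ((h^-1)%:C *: L h x) - t%:C *: ((h^-1)%:C *: L h x).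
have : g h @[h --> 0^'+] --> L t x - t%:C *: x.
  apply: cvgB; last exact: cvgZl_tmp.
  have Lc : continuous (L t) by exact: orbit_integral_continuous.
  exact: (cvg_comp _ _ LD (Lc _)).
apply: cvg_trans; apply: near_eq_cvg; near=> h.
have h0 : 0 <= h by apply: ltW; near: h; exact: nbhs_right_gt.
have lin : linear (fun y : V => (T h y - y : V)).
  by move=> a u v; rewrite linearP scalerBr opprD addrACA.
have cTh : continuous (linear_of lin).
  by move=> y; apply: (@cvgB _ X); [exact: (c0_bounded hT h0) | exact: cvg_id].
have cL : {within `[0, +oo[, continuous (fun s => L s x : V)}.
  exact: integral_continuous (orbit_cont x).
rewrite /diff_quot /g.
have -> : T h (orbit_integral2 t x) - orbit_integral2 t x =
    L t (L h x) - t%:C *: L h x.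
  rewrite -[LHS](integral_map cTh cL t0).
  rewrite -[t%:C *: _](integral_cst (L h x : V) t0).
  have -> : - integral (fun=> L h x : V) t = integral (fun=> - L h x : V) t.
    by rewrite !integral_cst// scalerN.
  rewrite -[RHS](integralD (orbit_cont (L h x)))//; last first.
    by apply: continuous_subspaceT => s; exact: cvg_cst.
  by apply: (@eq_integral R V) => s s0; rewrite /= orbit_integral_symm.
pose Lt := linear_of (orbit_integral_linear t0).
rewrite -[L t ((_)^-1%:C *: _)]/(Lt _) linearZ /= scalerBr.
by rewrite !scalerA [t%:C * _]mulrC.
Unshelve. all: by end_near. Qed.

End SemigroupIntegral.

(** * Finite-dimensional subspaces and ranges of powers *)

Section FiniteDimension.
Context (K : numFieldType) (X : normedModType K).

Definition linear_subspace (W : set X) :=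
  W 0 /\ forall (a : K) x y, W x -> W y -> W (a *: x + y).

Lemma linear_subspaceD W x y : linear_subspace W -> W x -> W y -> W (x + y).
Proof. by move=> [_ sW] Wx Wy; rewrite -[x]scale1r; exact: sW. Qed.

Lemma linear_subspaceZ W (a : K) x : linear_subspace W -> W x -> W (a *: x).
Proof. by move=> [W0 sW] Wx; rewrite -[_ *: _]addr0; exact: sW. Qed.

Lemma linear_subspaceB W x y : linear_subspace W -> W x -> W y -> W (x - y).
Proof.
by move=> sW Wx Wy; rewrite -scaleN1r addrC; apply: sW.2.
Qed.

Lemma linear_subspace_sum W n (c : 'I_n -> K) (v : 'I_n -> X) :
  linear_subspace W -> (forall i, W (v i)) -> W (\sum_(i < n) c i *: v i).
Proof.
move=> sW Wv; elim/big_ind: _ => [|x y|i _]; first exact: sW.1.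
  exact: linear_subspaceD.
exact: linear_subspaceZ.
Qed.

Lemma op_range_subspace (S : linop X) : linear_subspace (op_range S).
Proof.
split; first by exists 0; [exact: op_dom0 | exact: linop0].
move=> a _ _ [x Sx <-] [y Sy <-]; exists (a *: x + y); first exact: op_domP.
exact: op_funP.
Qed.

Lemma op_ker_subspace (S : linop X) : linear_subspace (op_ker S).
Proof.
split; first by split; [exact: op_dom0 | exact: linop0].
move=> a x y [Sx x0] [Sy y0]; split; first exact: op_domP.
by rewrite op_funP// x0 y0 scaler0 addr0.
Qed.

(** Induction on the number of generators of [V].  Either [W] already lies in
    the span of all generators but the last, or it has a vector [x0] with a
    nonzero last coefficient, and subtracting multiples of [x0] reduces [W] to
    its intersection with that span. *)
Lemma finite_dim_sub (W V : set X) :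
  linear_subspace W -> W `<=` V -> finite_dim V -> finite_dim W.
Proof.
move=> sW WV [n [v VE]]; move: WV sW; rewrite VE => {V VE}.
elim: n v W => [|n IH] v W WV sW.
  exists 0, v; apply/seteqP; split=> [x /WV [c _ <-]|_ [c _ <-]].
    by exists c.
  by rewrite big_ord0; exact: sW.1.
pose v' (i : 'I_n) := v (widen_ord (leqnSn n) i).
pose H : set X := [set \sum_(i < n) c i *: v' i | c in [set: 'I_n -> K]].
have [m [w Ww]] : finite_dim (W `&` H).
  apply: (IH v') => [x [_ Hx]|]; first exact: Hx.
  split.
    split; first exact: sW.1.
    by exists (fun=> 0) => //; rewrite big1// => i _; rewrite scale0r.
  move=> a x y [Wx [c _ cx]] [Wy [d _ dy]]; split; first exact: sW.2.
  exists (fun i => a * c i + d i) => //; rewrite -cx -dy scaler_sumr -big_split.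
  by apply: eq_bigr => i _; rewrite scalerDl scalerA.
have wW i : W (w i).
  suff [] : (W `&` H) (w i) by [].
  rewrite Ww; exists (fun j => (j == i)%:R) => //.
  rewrite (bigD1 i)//= eqxx scale1r big1 ?addr0// => j /negbTE ->.
  by rewrite scale0r.
have [WH|/existsNP[x0 /not_implyP[Wx0 nHx0]]] := pselect (W `<=` H).
  exists m, w; rewrite -Ww; apply/seteqP; split=> [x Wx|x []//].
  by split=> //; exact: WH.
have [c _ cx0] := WV _ Wx0.
have c0 : c ord_max != 0.
  apply/eqP => c0; apply: nHx0; exists (fun i => c (widen_ord (leqnSn n) i)) => //.
  by rewrite -cx0 big_ord_recr/= c0 scale0r addr0.
exists m.+1, (fun i => oapp w x0 (unlift ord_max i)).
have E (e : 'I_m.+1 -> K) : \sum_(i < m.+1) e i *: oapp w x0 (unlift ord_max i) =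
    \sum_(i < m) e (lift ord_max i) *: w i + e ord_max *: x0.
  rewrite big_ord_recr /= unlift_none /=; congr (_ + _).
  apply: eq_bigr => i _.
  have -> : widen_ord (leqnSn m) i = lift ord_max i.
    by apply/val_inj/esym; exact: lift_max.
  by rewrite liftK.
apply/seteqP; split=> [x Wx|_ [e _ <-]]; last first.
  by rewrite E; apply: linear_subspaceD => //; [exact: linear_subspace_sum | exact: linear_subspaceZ].
have [d _ dx] := WV _ Wx.
pose a := d ord_max / c ord_max.
have : (W `&` H) (x - a *: x0).
  split; first by apply: linear_subspaceB => //; exact: linear_subspaceZ.
  pose j (i : 'I_n) := widen_ord (leqnSn n) i.
  exists (fun i => d (j i) - a * c (j i)) => //; rewrite -dx -cx0 !big_ord_recr/=.
  rewrite scalerDr scalerA divfK// opprD addrACA subrr addr0.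
  rewrite scaler_sumr -sumrB; apply: eq_bigr => i _.
  by rewrite scalerBl scalerA.
rewrite Ww => -[e _ ex].
exists (fun i => oapp e a (unlift ord_max i)) => //.
rewrite E /= unlift_none /=; under eq_bigr do rewrite liftK.
by rewrite ex subrK.
Qed.

End FiniteDimension.

Section Bezout.
Context (K : numFieldType) (X : normedModType K).
(** A factorization [F = B L = L B] into two factors that are coprime, by the
    Bezout identity [c = L - B M].  Only [B] may be unbounded. *)
Variables (B F : linop X) (L : {linear X -> X}) (M : X -> X) (c : K).
Hypothesis c0 : c != 0.
Hypothesis domF : forall x, op_dom F x.
Hypothesis BL : forall x, op_dom B (L x) /\ B (L x) = F x.
Hypothesis LB : forall x, op_dom B x -> L (B x) = F x.
Hypothesis BM : forall x, op_dom B (M x) /\ B (M x) = L x - c *: x.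

Local Notation RB n := (op_range (pow_op B n)).
Local Notation RF n := (op_range (pow_op F n)).

Lemma range_pow0 (S : linop X) x : op_range (pow_op S 0) x.
Proof. by exists x. Qed.

Lemma range_powS (S : linop X) n x :
  op_dom S x -> op_range (pow_op S n) x -> op_range (pow_op S n.+1) (S x).
Proof. by move=> Sx [y Sy yx]; exists y => /=; [rewrite yx | rewrite yx]. Qed.

Lemma range_powSP (S : linop X) n z : op_range (pow_op S n.+1) z ->
  exists x, [/\ op_dom S x, op_range (pow_op S n) x & S x = z].
Proof. by move=> [y [Sy SSy] yz]; exists (pow_op S n y); split=> //; exists y. Qed.

Lemma range_pow_dec (S : linop X) n x :
  op_range (pow_op S n.+1) x -> op_range (pow_op S n) x.
Proof.
elim: n x => [|n IH] x; first by move=> _; exact: range_pow0.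
by move=> /range_powSP[y [Sy /IH ny <-]]; exact: range_powS.
Qed.

(** Thus the codimension in the Fredholm property of the restriction of [S] to
    [R(S^n)] is that of [R(S^(n+1))] in [R(S^n)]. *)
Lemma range_powE (S : linop X) n :
  op_range (pow_op S n.+1) = op_range (part_op S n).
Proof.
apply/seteqP; split=> [z /range_powSP[x [Sx nx <-]]|_ [x [Sx nx] <-]].
  by exists x.
exact: range_powS.
Qed.

Lemma range_stable n x : RB n x -> RB n (L x).
Proof.
elim: n x => [|n IH] x; first by move=> _; exact: range_pow0.
move=> /range_powSP[y [By ny <-]].
by rewrite LB// -(BL y).2; apply: range_powS; [exact: (BL y).1 | exact: IH].
Qed.

(** For [n = 0] this is the Bezout identity; then [L - c], which commutes with
    [B], is carried through the powers of [B]. *)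
Lemma range_step n x : RB n x -> RB n.+1 (L x - c *: x).
Proof.
elim: n x => [|n IH] x.
  move=> _; rewrite -(BM x).2.
  by apply: range_powS; [exact: (BM x).1 | exact: range_pow0].
move=> /range_powSP[y [By ny <-]].
have -> : L (B y) - c *: B y = B (L y - c *: y).
  rewrite LB// -(BL y).2 addrC -scaleNr -op_funP//; first by rewrite scaleNr addrC.
  exact: (BL y).1.
apply: range_powS; last exact: IH.
by rewrite addrC -scaleNr; apply: op_domP => //; exact: (BL y).1.
Qed.

Lemma range_product_sub n : RF n `<=` RB n.
Proof.
elim: n => [|n IH] x; first by move=> _; exact: range_pow0.
move=> /range_powSP[y [_ /IH ny <-]].
rewrite -(BL y).2; apply: range_powS; first exact: (BL y).1.
exact: range_stable.
Qed.

Lemma cofactor_product_comm x : L (F x) = F (L x).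
Proof. by rewrite -(BL x).2 LB//; exact: (BL x).1. Qed.

Lemma iter_cofactor_product_comm n x : iter n L (F x) = F (iter n L x).
Proof. by elim: n => //= n ->; rewrite cofactor_product_comm. Qed.

(** If [x = B^n y] then [L^n x = (L B)^n y = F^n y]. *)
Lemma iter_cofactor_range n x : RB n x -> RF n (iter n L x).
Proof.
elim: n x => [|n IH] x; first by move=> _; exact: range_pow0.
move=> /range_powSP[y [By ny <-]].
rewrite iterSr LB// iter_cofactor_product_comm; apply: range_powS => //; exact: IH.
Qed.

Let Q x := L x - c *: x.

Lemma cofactor_step_comm x : L (Q x) = Q (L x).
Proof. by rewrite /Q linearB /= linearZ. Qed.

Lemma iter_step_range n x : RB n (iter n Q x).
Proof.
elim: n => [|n IH]; first exact: range_pow0.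
exact: range_step.
Qed.

(** The subspace [RB n] contains the ranges of [Q^n], and is stable under [L]
    and [Q].  Since [c x = L x - Q x], a double induction on the exponents
    shows that [x] belongs to it as soon as some iterates [L^k x] and [Q^j x]
    do. *)
Lemma range_iter_cancel n k x : RB n (iter k L x) -> RB n x.
Proof.
have sB := op_range_subspace (pow_op B n).
have stabQ y : RB n y -> RB n (Q y).
  by move=> ny; apply: linear_subspaceB => //; [exact: range_stable | exact: linear_subspaceZ].
have LQ_ j y : iter j Q (L y) = L (iter j Q y).
  by elim: j => //= j ->; rewrite cofactor_step_comm.
have QL_ j y : iter j L (Q y) = Q (iter j L y).
  by elim: j => //= j ->; rewrite cofactor_step_comm.
suff H j : RB n (iter k L x) -> RB n (iter j Q x) -> RB n x.
  by move=> kx; apply: (H n) => //; exact: iter_step_range.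
move: x; elim: k j => [//|k IHk] j.
elim: j => [//|j IHj] x kx jx.
have LX : RB n (L x).
  apply: (IHk j.+1); first by rewrite -iterSr.
  by rewrite LQ_; exact: range_stable.
have QX : RB n (Q x).
  apply: IHj; last by rewrite -iterSr.
  by rewrite QL_; exact: stabQ.
have -> : x = c^-1 *: (L x - Q x).
  by rewrite /Q opprB addrC subrK scalerA mulVf// scale1r.
by apply: linear_subspaceZ => //; exact: linear_subspaceB.
Qed.

(** On [RB n], [L] is the scalar [c] modulo [RB n.+1]. *)
Lemma range_iter_mod n k x : RB n x -> RB n.+1 (iter k L x - c ^+ k *: x).
Proof.
move=> nx; elim: k => [|k IH].
  by rewrite expr0 scale1r subrr; exact: (op_range_subspace _).1.
have -> : iter k.+1 L x - c ^+ k.+1 *: x =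
    L (iter k L x - c ^+ k *: x) + c ^+ k *: Q x.
  rewrite /Q linearB [L (_ *: _)]linearZ /= [c ^+ k *: (_ - _)]scalerBr.
  by rewrite scalerA -exprSr addrA subrK.
apply: linear_subspaceD; first exact: op_range_subspace.
  exact: range_stable.
apply: linear_subspaceZ; first exact: op_range_subspace.
exact: range_step.
Qed.

Lemma iter_cofactor_ker k x : L x = c *: x ->
  iter k L x = c ^+ k *: x.
Proof.
move=> Lx; elim: k => [|k IH]; first by rewrite expr0 scale1r.
by rewrite iterS IH linearZ /= Lx scalerA exprSr.
Qed.

Hypothesis kerL : forall x, op_dom B x -> B x = 0 -> L x = c *: x.
Hypothesis Lcont : continuous L.
Hypothesis Bclosed : closure (op_graph B) `<=` op_graph B.

(** The power that works for [F] works for [B]. *)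
Lemma bezout_b_fredholm : b_fredholm F -> b_fredholm B.
Proof.
move=> [n [clF [_ kerF [m [v cokF]]]]]; exists n; split; [|split].
(* L^n maps the closure of RB n into RF n, because RF n is closed. *)
- rewrite closure_id; apply/seteqP; split; first exact: subset_closure.
  move=> x clx; apply: (@range_iter_cancel n n); apply: range_product_sub.
  apply: (clF : closure _ `<=` _); move=> U nU.
  have contLn : continuous (iter n L).
    elim: (n) => [|k IH] y; first exact: cvg_id.
    by apply: continuous_comp; [exact: IH | exact: Lcont].
  have [y [ny Uy]] := clx _ (contLn x U nU).
  by exists (iter n L y); split=> //; exact: iter_cofactor_range.
- move=> [x y] /= [clxy [nx ny]].
  have [] : op_graph B (x, y).
    apply: Bclosed; apply: closureS clxy.
    by move=> -[u w] /= [[Bu nu] wu]; split.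
  by move=> /= Bx yx; split.
- apply: finite_dim_sub kerF; first exact: op_ker_subspace.
  move=> x [[Bx nx] x0]; split; first (split; first exact: domF).
    (* c^n x = L^n x belongs to RF n. *)
    have Lnx := iter_cofactor_ker n (kerL Bx x0).
    have -> : x = (c ^+ n)^-1 *: iter n L x.
      by rewrite Lnx scalerA mulVf ?scale1r// expf_neq0.
    by apply: linear_subspaceZ; [exact: op_range_subspace | exact: iter_cofactor_range].
  by rewrite /= -LB// [B x]x0 linear0.
(* Modulo RB n.+1, c^n x is L^n x, which the v i generate modulo RF n.+1. *)
- exists m, v; rewrite -range_powE; apply/seteqP; split=> x.
    move=> nx; have := iter_cofactor_range nx; rewrite {1}cokF => -[y].
    rewrite -range_powE => /range_product_sub ny [d _ dx].
    exists ((c ^+ n)^-1 *: (y - (iter n L x - c ^+ n *: x))).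
      apply: linear_subspaceZ; first exact: op_range_subspace.
      apply: linear_subspaceB; first exact: op_range_subspace.
        exact: ny.
      exact: range_iter_mod.
    exists (fun i => (c ^+ n)^-1 * d i) => //.
    rewrite -dx opprB.
    have -> : \sum_(i < m) ((c ^+ n)^-1 * d i) *: v i =
        (c ^+ n)^-1 *: \sum_(i < m) d i *: v i.
      by rewrite scaler_sumr; apply: eq_bigr => i _; rewrite scalerA.
    rewrite -scalerDr.
    by rewrite addrAC addrC subrK scalerA mulVf ?scale1r// expf_neq0.
  move=> [y ny [d _ <-]]; apply: linear_subspaceD; first exact: op_range_subspace.
    exact: range_pow_dec.
  apply: linear_subspace_sum; first exact: op_range_subspace.
  move=> i; apply: range_product_sub; rewrite cokF; exists 0.
    exact: (op_range_subspace _).1.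
  exists (fun j => (j == i)%:R) => //.
  rewrite add0r (bigD1 i)//= eqxx scale1r big1 ?addr0// => j /negbTE ->.
  by rewrite scale0r.
Qed.

End Bezout.

(** * The rescaled semigroup *)

Section Rescaling.
Context (R : realType) (X : completeNormedModType R[i]).
Implicit Types (T : R -> {linear X -> X}) (mu : R[i]).

Definition rescaled T mu (s : R) : {linear X -> X} :=
  cexp (s%:C * mu) \*: T s.

Lemma rescaled_c0 T mu : c0_semigroup T -> c0_semigroup (rescaled T mu).
Proof.
move=> hT; split.
- move=> t t0 x; apply: cvgZl_tmp; exact: (c0_bounded hT t0).
- by move=> x; rewrite /= /GRing.scale_fun /= mul0r cexp0 scale1r (c0_id hT).
- move=> s t x s0 t0; rewrite /= (c0_add hT)//.
  by rewrite [T s (_ *: _)]linearZ /= scalerA rmorphD mulrDl cexpD.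
- move=> x; apply/subspace_continuousP => s s0.
  apply: cvgZ; last by have /subspace_continuousP := @c0_strong _ _ _ hT x; exact.
  by apply: cvg_within_filter; exact: cexp_continuous.
Qed.

(** Product rule at the origin for [s |-> e^(s mu) T(s) x]. *)
Lemma generates_rescaled T mu x y :
  generates T x y -> generates (rescaled T mu) x (y + mu *: x).
Proof.
move=> xy.
have ce : (cexp (h%:C * mu) : R[i]^o) @[h --> (0 : R)^'+] --> (1 : R[i]^o).
  have -> : 1 = cexp ((0 : R)%:C * mu) by rewrite mul0r cexp0.
  by apply: cvg_at_right_filter; exact: cexp_continuous.
have : cexp (h%:C * mu) *: diff_quot T x h +
    ((h^-1)%:C * (cexp (h%:C * mu) - 1)) *: x @[h --> (0 : R)^'+] -->
    1 *: y + mu *: x.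
  apply: cvgD; first exact: cvgZ.
  by apply: cvgZr_tmp; exact: cexp_derivative0.
rewrite scale1r; apply: cvg_trans; apply: near_eq_cvg; apply: nearW => h.
rewrite /diff_quot /= -[X in _ + X]scalerA scalerA mulrC -scalerA -scalerDr.
by rewrite scalerBr scalerBl scale1r addrA subrK.
Qed.

(** The converse is obtained by undoing the rescaling. *)
Lemma generates_rescaledP T mu x y :
  generates (rescaled T mu) x y <-> generates T x (y - mu *: x).
Proof.
split=> [|/(@generates_rescaled _ mu)]; last by rewrite subrK.
move=> /(@generates_rescaled _ (- mu)); rewrite scaleNr.
rewrite /generates /diff_quot /=.
under eq_cvg => s do rewrite scalerA -cexpD mulrN addNr cexp0 scale1r.
by [].
Qed.

Lemma generatorP T x y :
  generates T x y <-> op_dom (generator T) x /\ generator T x = y.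
Proof.
split=> [xy|[cx <-]]; last exact: cx.
by split; [apply/cvg_ex; exists y; exact: xy | exact/cvg_lim].
Qed.

Lemma shift_generatorP T mu x y :
  generates (rescaled T (- mu)) x y <->
  op_graph (shift_op (generator T) mu) (x, y).
Proof.
rewrite generates_rescaledP scaleNr opprK generatorP.
split=> -[Dx E]; split=> //.
  by rewrite -[RHS]/(generator T x - mu *: x) E addrK.
by have -> : y = generator T x - mu *: x by []; rewrite subrK.
Qed.

End Rescaling.

Theorem theorem3p1 (R : realType) (X : completeNormedModType R[i])
    (T : R -> {linear X -> X}) :
  c0_semigroup T ->
  forall t : R, 0 < t ->
    [set cexp (t%:C * mu) | mu in sigma_BF (generator T)]
      `<=` sigma_BF (total_op (T t)).
Proof.
move=> hT t t0 _ [mu muA <-] bfF; apply: muA.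
have t0' := ltW t0.
set B := shift_op (generator T) mu; pose e := cexp (t%:C * mu).
pose S := rescaled T (- mu).
have hS : c0_semigroup S by exact: rescaled_c0.
have genP x y : generates S x y <-> op_graph B (x, y) by exact: shift_generatorP.
have genZ x y : generates S x y -> generates S (e *: x) (e *: y).
  move=> xy; have : e *: diff_quot S x h @[h --> 0^'+] --> e *: y.
    exact: cvgZl_tmp.
  rewrite /generates /diff_quot.
  under eq_cvg do rewrite scalerA mulrC -scalerA scalerBr.
  by under [X in _ -> X]eq_cvg do rewrite linearZ.
(* The factor e turns S t - 1 into F, as e * cexp (- (t mu)) = 1. *)
pose L : {linear X -> X} := e \*: linear_of (orbit_integral_linear hS t0').
pose M x := e *: orbit_integral2 S t x.
pose F := shift_op (total_op (T t)) e.
have eS x : e *: (S t x - x) = F x.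
  by rewrite scalerBr /= scalerA -cexpD mulrN subrr cexp0 scale1r.
have BL x : op_dom B (L x) /\ B (L x) = F x.
  have /genZ/genP[BLx /= <-] := @orbit_integral_generates _ _ _ hS t x t0'.
  by rewrite eS.
apply: (@bezout_b_fredholm _ _ B F L M (e * t%:C) _ _ BL) bfF => //.
- by rewrite mulf_neq0 ?cexp_neq0// eq_complex /= eqxx andbT gt_eqF.
- move=> x Bx.
  have xBx : generates S x (B x) by apply/genP; split.
  by rewrite /L /= (generates_orbit_integral hS t0' xBx) eS.
- move=> x.
  have /genZ/genP[BMx /= <-] := @orbit_integral2_generates _ _ _ hS t x t0'.
  by split=> //; rewrite /L /= scalerBr scalerA.
- move=> x Bx Bx0.
  have x0 : generates S x 0 by apply/genP; split.
  by rewrite /L /= (generates_fixed hS x0 t0') scalerA.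
- move=> x; apply: cvgZl_tmp; exact: (orbit_integral_continuous hS t0').
- move=> p clp; apply/(genP p.1 p.2); apply: (generates_closed hS).
  by apply: closureS clp => -[x y] xy; apply/genP.
Qed.
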